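(* Let $n\ge 2$, let $f:\Gamma\to[0,\infty)$ satisfy properties (a)-(d) of the context and be nondegenerate, and let $\{(x,u(x)):x\in\mathbb{R}^n\}$ be the entire bowl-type solution for $f$. Then, up to a vertical translation (i.e. after adding a suitable constant to $u$), $$u(x)=\frac{|x|^2}{2f(0,\mathbf{e})}-\frac{\partial f}{\partial\lambda_1}(0,\mathbf{e})\,\ln(|x|)+O(|x|^{-1}),\qquad\text{as }|x|\to\infty .$$
   Context: Notation: $\mathbf{e}=(1,\ldots,1)\in\mathbb{R}^{n-1}$, $\Gamma_+=\{\lambda\in\mathbb{R}^n:\lambda_i>0 \text{ for all } i\}$. The function $f$ is smooth on $\Gamma$ and the properties are: (a) $\Gamma\subset\mathbb{R}^n$ is an open symmetric cone containing $\Gamma_+$; (b) $f$ is positive and symmetric in its $n$ variables; (c) $\partial f/\partial\lambda_i>0$ on $\Gamma$ for every $i$; (d) $f$ is $1$-homogeneous: $f(c\lambda)=cf(\lambda)$ for $c>0$. $f$ is nondegenerate if $(0,\mathbf{e})\in\Gamma$ and $f(0,\mathbf{e})>0$. A graph $\{(x,u(x))\}\subset\mathbb{R}^{n+1}$ is an $f$-translator if $f(\lambda)=\frac{1}{\sqrt{1+|Du|^2}}$, where $\lambda=(\lambda_1,\dots,\lambda_n)$ are the principal curvatures of the graph, with sign such that they are nonnegative when $u$ is convex. (Equivalently, the graph moves by translation with velocity $e_{n+1}$ under the flow with normal speed $f(\lambda)$.) For $u=u(r)$, $r=|x|$, one has $\lambda_1=\frac{u''}{(1+u'^2)^{3/2}}$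 and $\lambda_i=\frac{u'}{r\sqrt{1+u'^2}}$ for $i\ge2$. A bowl-type solution is a complete, strictly convex, rotationally symmetric (about the $x_{n+1}$-axis) $f$-translator that is a graph. For nondegenerate $f$ it is known that it exists, is entire (defined over all of $\mathbb{R}^n$), and is unique up to vertical translation. *)

(* Defs.v *)
From mathcomp Require Import all_boot all_order all_algebra all_fingroup.
From mathcomp Require Import all_classical all_reals all_analysis.

Set Implicit Arguments.
Unset Strict Implicit.
Unset Printing Implicit Defensive.

Import Order.TTheory GRing.Theory Num.Theory.
Import numFieldNormedType.Exports.

Local Open Scope classical_set_scope.
Local Open Scope ring_scope.

(* The library norm on 'rV[R]_n is the sup norm, hence a separate Euclidean
   norm. *)
Definition enorm (R : realType) (n : nat) (x : 'rV[R]_n) : R :=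
  Num.sqrt (\sum_(i < n) x 0 i ^+ 2).

Definition partial (R : realType) (n : nat) (i : 'I_n) (g : 'rV[R]_n -> R) :
    'rV[R]_n -> R :=
  'D_(delta_mx 0 i) g.

(* g is of class C^k on U; this only depends on the values of g on U when U is
   open. *)
Fixpoint class_C (R : realType) (n : nat) (U : set 'rV[R]_n) (k : nat)
    (g : 'rV[R]_n -> R) : Prop :=
  (forall x, U x -> {for x, continuous g}) /\
  match k with
  | 0%N => True
  | k'.+1 =>
      forall i : 'I_n,
        (forall x, U x -> derivable g x (delta_mx 0 i)) /\
        class_C U k' (partial i g)
  end.

Definition smooth_on (R : realType) (n : nat) (U : set 'rV[R]_n)
    (g : 'rV[R]_n -> R) : Prop :=
  forall k, class_C U k g.

(* The speed f is a total function whose values outside Gam are irrelevant. *)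
Record speed_function (R : realType) (n : nat) (Gam : set 'rV[R]_n)
    (f : 'rV[R]_n -> R) : Prop := SpeedFunction {
  speed_open : open Gam;
  speed_symcone : forall (s : 'S_n) lam, Gam lam -> Gam (col_perm s lam);
  speed_cone : forall (c : R) lam, 0 < c -> Gam lam -> Gam (c *: lam);
  speed_pos_cone : forall lam : 'rV[R]_n, (forall i, 0 < lam 0 i) -> Gam lam;
  speed_smooth : smooth_on Gam f;
  speed_pos : forall lam, Gam lam -> 0 < f lam;
  speed_sym : forall (s : 'S_n) lam, Gam lam -> f (col_perm s lam) = f lam;
  speed_mono : forall i lam, Gam lam -> 0 < partial i f lam;
  speed_homo : forall (c : R) lam, 0 < c -> Gam lam -> f (c *: lam) = c * f lam
}.

(* The vector (0, e) = (0, 1, ..., 1). *)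
Definition zero_e (R : realType) (n : nat) : 'rV[R]_n :=
  \row_(i < n) (0 < i)%N%:R.

Definition nondegenerate_speed (R : realType) (n : nat) (Gam : set 'rV[R]_n)
    (f : 'rV[R]_n -> R) : Prop :=
  Gam (zero_e R n) /\ 0 < f (zero_e R n).

Definition grad (R : realType) (n : nat) (u : 'rV[R]_n -> R) (x : 'rV[R]_n) :
    'rV[R]_n :=
  \row_(i < n) partial i u x.

Definition hessian (R : realType) (n : nat) (u : 'rV[R]_n -> R)
    (x : 'rV[R]_n) : 'M[R]_n :=
  \matrix_(i < n, j < n) partial i (partial j u) x.

Definition area_factor (R : realType) (n : nat) (u : 'rV[R]_n -> R)
    (x : 'rV[R]_n) : R :=
  Num.sqrt (1 + enorm (grad u x) ^+ 2).

(* Fundamental forms of the graph of u in the chart x |-> (x, u x), for the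
   unit normal (- Du, 1) / sqrt (1 + |Du|^2): the second form is nonnegative
   when u is convex. *)
Definition first_form (R : realType) (n : nat) (u : 'rV[R]_n -> R)
    (x : 'rV[R]_n) : 'M[R]_n :=
  1%:M + (grad u x)^T *m grad u x.

Definition second_form (R : realType) (n : nat) (u : 'rV[R]_n -> R)
    (x : 'rV[R]_n) : 'M[R]_n :=
  (area_factor u x)^-1 *: hessian u x.

Definition shape_operator (R : realType) (n : nat) (u : 'rV[R]_n -> R)
    (x : 'rV[R]_n) : 'M[R]_n :=
  invmx (first_form u x) *m second_form u x.

(* lam lists the eigenvalues of the shape operator with multiplicity. For u of
   class C^2 the shape operator is self-adjoint for the first fundamental form,
   so that such a lam exists and is unique up to a permutation. *)
Definition principal_curvatures (R : realType) (n : nat)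
    (u : 'rV[R]_n -> R) (x lam : 'rV[R]_n) : Prop :=
  char_poly (shape_operator u x) = \prod_(i < n) ('X - (lam 0 i)%:P).

Definition translator (R : realType) (n : nat) (Gam : set 'rV[R]_n)
    (f : 'rV[R]_n -> R) (u : 'rV[R]_n -> R) : Prop :=
  forall x lam, principal_curvatures u x lam ->
    Gam lam /\ f lam = (area_factor u x)^-1.

Definition strictly_convex (R : realType) (n : nat) (u : 'rV[R]_n -> R) :
    Prop :=
  forall (x y : 'rV[R]_n) (t : R), x != y -> 0 < t -> t < 1 ->
    u (t *: x + (1 - t) *: y) < t * u x + (1 - t) * u y.

Definition rotationally_symmetric (R : realType) (n : nat)
    (u : 'rV[R]_n -> R) : Prop :=
  forall x y, enorm x = enorm y -> u x = u y.

(* Completeness of the hypersurface is automatic: the graph of a continuous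
   function defined on the whole of R^n is closed in R^(n+1). *)
Record entire_bowl (R : realType) (n : nat) (Gam : set 'rV[R]_n)
    (f : 'rV[R]_n -> R) (u : 'rV[R]_n -> R) : Prop := EntireBowl {
  bowl_C2 : class_C setT 2 u;
  bowl_strictly_convex : strictly_convex u;
  bowl_rotationally_symmetric : rotationally_symmetric u;
  bowl_translator : translator Gam f u
}.

(* Main.v *)
Require Import Defs.
From mathcomp Require Import all_boot all_order all_algebra all_fingroup.
From mathcomp Require Import all_classical all_reals all_analysis.
From mathcomp Require Import ring lra.

Set Implicit Arguments.
Unset Strict Implicit.
Unset Printing Implicit Defensive.

Import Order.TTheory GRing.Theory Num.Theory.
Import numFieldNormedType.Exports.

Local Open Scope classical_set_scope.
Local Open Scope ring_scope.

(* Let phi be the radial profile of u, p := phi', A := f(0,e), B := d_1 f(0,e) and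
   g(s) := f(s,e). By 1-homogeneity the translator equation reads g(t) = y with
   y := r / p and t := r p' / (p (1 + p^2)), so that
     r y' = y - t (y + r^2 / y),
   and strict convexity gives t >= 0, i.e. y >= A. As t is increasing in y, the
   term t r^2 / y forces y down on a fast scale: successively y <= 2 A,
   y <= A + O(r^-2), and r^2 (y - A) = A^2 B + O(r^-1), the equilibrium value
   that balances y = t r^2 / y with t ~ (y - A) / B. Hence
   p = r / A - B / r + O(r^-2), which is integrated once. *)

(** * Asymptotics of the slope equation *)

(* Wherever D <= 0, D grows at least like k ln r. *)
Lemma eventually_nonneg {R : realType} (D D' : R -> R) (k : R) : 0 < k ->
  (\forall r \near +oo, is_derive (r : R) 1 D (D' r)) ->
  (\forall r \near +oo, D r <= 0 -> k / r <= D' r) ->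
  \forall r \near +oo, 0 <= D r.
Proof.
move=> k0 dD hD.
have /= [M [_ HM]] := filterI dD hD.
(* Both eventual facts hold beyond [M], hence on the closed half-line from [r0]; the 1 keeps [r]
   positive, as [ln r] and [k / r] require. *)
pose r0 := Num.max 1 (M + 1).
have r0_gt0 : 0 < r0 by rewrite lt_max ltr01.
have M_lt r : r0 <= r -> M < r.
  by apply: lt_le_trans; rewrite lt_max ltrDl ltr01 orbT.
have dD0 r : r0 <= r -> is_derive r 1 D (D' r) by move=> /M_lt/HM[].
have hD0 r : r0 <= r -> D r <= 0 -> k / r <= D' r by move=> /M_lt/HM[].
have cD a b : r0 <= a -> {within `[a, b], continuous D}.
  move=> ra; apply: derivable_within_continuous => x.
  rewrite in_itv/= => /andP[ax _].
  by have [] := dD0 x (le_trans ra ax).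
have [r1 r01 Dr1] : exists2 r1, r0 <= r1 & 0 <= D r1.
  apply: contrapT => noD.
  have Dlt r : r0 <= r -> D r < 0.
    by move=> rr; rewrite ltNge; apply/negP => Dr; apply: noD; exists r.
  (* If [D] stayed negative, [D - k ln r] would be nondecreasing from [r0] on. As
     [k ln (r2 / r0) = - D r0], this forces [D r2 >= 0]. *)
  pose r2 := r0 * expR (- D r0 / k).
  have r02 : r0 < r2.
    rewrite ltr_pMr// -expR0 ltr_expR divr_gt0// oppr_gt0.
    exact: Dlt.
  have d r : r \in `]r0, r2[ ->
      is_derive r 1 (fun s => D s - k * ln s) (D' r - k / r).
    rewrite in_itv/= => /andP[/ltW rr _].
    have rpos : 0 < r by apply: lt_le_trans rr.
    have ? := dD0 r rr; have ? := is_derive1_ln rpos.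
    by apply: (is_deriveB (g := k \*: (@ln R))).
  have c : {within `[r0, r2], continuous (fun s => D s - k * ln s)}.
    apply: derivable_within_continuous => x.
    rewrite in_itv/= => /andP[ax _].
    have xpos : 0 < x by apply: lt_le_trans ax.
    by have [] := is_deriveB (dD0 x ax) (is_deriveZ k (is_derive1_ln xpos)).
  have [s] := MVT r02 d c.
  rewrite in_itv/= => /andP[/ltW rs _].
  have hs : 0 <= D' s - k / s by rewrite subr_ge0 hD0// ltW// Dlt.
  have -> : D r2 - k * ln r2 - (D r0 - k * ln r0) = D r2.
    rewrite lnM ?posrE ?expR_gt0// expRK mulrDr (mulrC k (_ / k)) divfK ?gt_eqF//.
    ring.
  move=> Dr2; have := Dlt _ (ltW r02).
  by rewrite Dr2 ltNge mulr_ge0// subr_ge0 ltW.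
near=> r2.
have r12 : r1 < r2 by near: r2; apply: nbhs_pinfty_gt; exact: num_real.
rewrite leNgt; apply/negP => Dr2.
(* A negative minimum over [r1, r2] sits at some [m > r1]. Just to the left of [m] the function is
   still negative, hence increasing, which contradicts minimality. *)
have [m] := EVT_min (ltW r12) (cD r1 r2 r01).
rewrite in_itv/= => /andP[r1m mr2] mmin.
have Dm : D m < 0.
  by apply: le_lt_trans Dr2; apply: mmin; rewrite in_itv/= lexx ltW.
have {}r1m : r1 < m.
  rewrite lt_neqAle r1m andbT; apply/eqP => r1m'.
  by move: Dm; rewrite -r1m' ltNge Dr1.
have [dm _] := dD0 m (le_trans r01 (ltW r1m)).
have cm : {for m, continuous D}.
  by apply: differentiable_continuous; apply/derivable1_diffP.
have : \forall z \near m, D z < 0 by exact: (cvgr_lt _ cm _ Dm).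
move=> /nbhs_ballP[e /= e0 he].
pose a := Num.max r1 (m - e / 2).
have am : a < m by rewrite gt_max r1m/= ltrBlDr ltrDl divr_gt0.
have ra : r0 <= a by rewrite le_max r01.
have d x : x \in `]a, m[ -> is_derive x 1 D (D' x).
  by rewrite in_itv/= => /andP[/ltW ax _]; apply: dD0; apply: le_trans ax.
have [c] := MVT am d (cD a m ra).
rewrite in_itv/= => /andP[ac cm'] eqD.
have Dc : D c < 0.
  apply: he; rewrite /ball/= ltr_norml.
  move: ac; rewrite gt_max => /andP[_ ac].
  by apply/andP; split; lra.
have rc : r0 <= c by apply: le_trans ra (ltW ac).
have D'c : 0 < D' c.
  apply: lt_le_trans (hD0 c rc (ltW Dc)).
  by rewrite divr_gt0// (lt_le_trans r0_gt0).
have : D m <= D a.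
  by apply: mmin; rewrite in_itv/= le_max lexx/= (le_trans (ltW am)).
by rewrite -subr_le0 eqD leNgt mulr_gt0// subr_gt0.
Unshelve. all: by end_near.
Qed.

Lemma pinfty_gt {R : realType} (c : R) : \forall r \near +oo, c < r.
Proof. by apply: nbhs_pinfty_gt; exact: num_real. Qed.

Lemma pinfty_inv_lt {R : realType} (e : R) : 0 < e ->
  \forall r \near +oo, r^-1 < e.
Proof.
move=> e0; near=> r.
have r0 : 0 < r by near: r; exact: pinfty_gt.
rewrite invf_plt ?posrE//; near: r; exact: pinfty_gt.
Unshelve. all: by end_near.
Qed.

(** Meant for [g(s) = f(s, e)], and restricted to [s >= 0], where the ray lies in the cone. The
    derivative [B] at 0 enters through a Taylor bound with quadratic remainder. *)
Record speed_profile {R : realType} (A B : R) (g : R -> R) : Prop :=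
  SpeedProfile {
  profile_A : 0 < A;
  profile_B : 0 < B;
  profile_mono : forall s s', 0 <= s -> s < s' -> g s < g s';
  profile_taylor : exists2 d : R, 0 < d & exists M : R,
    forall s, 0 <= s <= d -> `|g s - (A + B * s)| <= M * s ^+ 2;
  profile_0 : g 0 = A
}.

(* y stands for r / u', and t for the ratio of the radial to the rotational
   principal curvature. *)
Record slope_ode {R : realType} (g y t : R -> R) : Prop := SlopeODE {
  ode_pos : forall r, 0 < r -> 0 < y r;
  ode_t : forall r, 0 < r -> 0 <= t r;
  ode_g : forall r, 0 < r -> g (t r) = y r;
  ode_derive : forall r : R, 0 < r ->
    is_derive r 1 y (y r / r - t r * (y r / r + r / y r))
}.

(** For small [s] half of the linear term absorbs the quadratic remainder. The bound on [d] gives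
    [g d <= 2 * A], so that [y >= 2 * A] forces [t >= d]. *)
Lemma profile_linear {R : realType} (A B : R) (g : R -> R) :
  speed_profile A B g -> exists2 d : R, 0 < d & 2 * B * d <= A /\
    forall s, 0 <= s <= d -> A + B / 2 * s <= g s <= A + 2 * B * s.
Proof.
move=> [A0 B0 _ [d d0 [M HM]] _].
(* [M] may be nonpositive, whereas [N] has to serve as a divisor. *)
pose N := `|M| + 1.
have N0 : 0 < N by rewrite ltr_wpDl.
exists (Num.min d (Num.min (B / (2 * N)) (A / (2 * B)))).
  by rewrite !lt_min d0 !divr_gt0// mulr_gt0.
split.
  rewrite mulrC -ler_pdivlMr ?mulr_gt0// !ge_min lexx !orbT//.
move=> s; rewrite !le_min => /andP[s0 /andP[sd /andP[sN _]]].
have /HM : 0 <= s <= d by rewrite s0.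
rewrite ler_norml => /andP[].
have hM : M * s ^+ 2 <= B / 2 * s.
  rewrite ler_pdivlMr ?mulr_gt0// in sN.
  apply: (@le_trans _ _ (N * s ^+ 2)).
    by rewrite ler_wpM2r ?sqr_ge0// (le_trans (ler_norm _)) ?lerDl.
  by nra.
by move=> *; apply/andP; split; nra.
Qed.

Lemma profile_le {R : realType} (A B : R) (g : R -> R) (s s' : R) :
  speed_profile A B g -> 0 <= s -> 0 <= s' -> g s <= g s' -> s <= s'.
Proof.
move=> hg s0 s'0 gs; rewrite leNgt; apply/negP => /(profile_mono hg s'0).
by rewrite ltNge gs.
Qed.

Lemma slope_ge {R : realType} (A B : R) (g y t : R -> R) (r : R) :
  speed_profile A B g -> slope_ode g y t -> 0 < r -> A <= y r.
Proof.
move=> hg hy r0; rewrite -(ode_g hy)// -(profile_0 hg).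
have := ode_t hy r0; rewrite le_eqVlt => /predU1P[<-//|t0].
exact/ltW/(profile_mono hg).
Qed.

Lemma is_derive_inv {R : realType} (r : R) : 0 < r ->
  is_derive r 1 GRing.inv (- r^-1 ^+ 2).
Proof.
move=> r0; have rN0 : id r != 0 by rewrite gt_eqF.
have d := is_deriveV rN0 (is_derive_id r 1).
by apply: (is_derive_eq d); rewrite /GRing.scale/= mulr1 exprVn.
Qed.

(* In terms of v := (y / r) ^ 2, i.e. of the inverse square slope, the equation
   reads r v' = - 2 t (1 + v); while y >= 2 A the factor t is bounded below. *)
Lemma slope_eventually_le {R : realType} (A B : R) (g y t : R -> R) :
  speed_profile A B g -> slope_ode g y t ->
  \forall r \near +oo, y r <= 2 * A.
Proof.
move=> hg hy; have A0 := profile_A hg.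
have [d d0 [hdA hd]] := profile_linear hg.
(* This is [(2 A / r)^2 - v], with the sign of [2 A - y]. Where it is nonpositive, [t >= d], and the
   contribution [8 A^2 / r^3] of the barrier costs at most half of [2 t / r]. *)
pose D : R -> R := (cst (4 * A ^+ 2) - y ^+ 2) * GRing.inv ^+ 2.
pose D' r := 2 * t r * (r^-1 + y r ^+ 2 * r^-1 ^+ 3) - 8 * A ^+ 2 * r^-1 ^+ 3.
have dD r : 0 < r -> is_derive (r : R) 1 D (D' r).
  move=> r0; have ? := ode_derive hy r0.
  have ? := is_derive_inv r0.
  have y0 := ode_pos hy r0.
  apply: is_derive_eq; rewrite /D' /= /GRing.scale /= !fctE.
  by field; rewrite !gt_eqF.
have HD : \forall r \near +oo, 0 <= D r.
  apply: (eventually_nonneg (D' := D') d0).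
    by near=> r; apply: dD; near: r; exact: pinfty_gt.
  near=> r => Dr.
  have r0 : 0 < r by near: r; exact: pinfty_gt.
  have x0 : 0 < r^-1 by rewrite invr_gt0.
  have y0 := ode_pos hy r0.
  have Ay : 2 * A <= y r.
    move: Dr; rewrite /D/= !fctE pmulr_lle0 ?exprn_gt0// subr_le0 => Dr.
    by rewrite leNgt; apply/negP => ?; nra.
  have dt : d <= t r.
    apply: (profile_le hg (ltW d0) (ode_t hy r0)).
    rewrite (ode_g hy)//.
    have /andP[_ gd] : A + B / 2 * d <= g d <= A + 2 * B * d.
      by apply: hd; rewrite lexx ltW.
    by lra.
  have x1 : r^-1 < 1 by near: r; exact: pinfty_inv_lt.
  have xd : r^-1 < d / (8 * A ^+ 2).
    by near: r; apply: pinfty_inv_lt; rewrite divr_gt0// mulr_gt0// exprn_gt0.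
  rewrite /D'; set x := r^-1 in x0 x1 xd *.
  rewrite ltr_pdivlMr ?mulr_gt0 ?exprn_gt0// in xd.
  have h1 : 8 * A ^+ 2 * x ^+ 3 <= d * x.
    have -> : 8 * A ^+ 2 * x ^+ 3 = (x * (8 * A ^+ 2)) * x * x by ring.
    by rewrite ler_pM2r// -[leRHS]mulr1 ler_pM ?mulr_ge0 ?ltW// mulr_gt0// exprn_gt0.
  have h2 : d * x <= t r * x by rewrite ler_pM2r.
  have h3 : 0 <= t r * (y r ^+ 2 * x ^+ 3).
    by rewrite !mulr_ge0 ?exprn_ge0 ?(ode_t hy)// ltW.
  by lra.
near=> r.
have r0 : 0 < r by near: r; exact: pinfty_gt.
have : 0 <= D r by near: r.
rewrite /D/= !fctE pmulr_lge0 ?exprn_gt0 ?invr_gt0// subr_ge0.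
have y0 := ode_pos hy r0.
by rewrite leNgt => ?; rewrite leNgt; apply/negP => ?; nra.
Unshelve. all: by end_near.
Qed.

(** Once [y <= 2 A], [t] dominates a multiple of [y - A]. Hence above the barrier [A + K / r^2] the
    damping [t r / y] outweighs the growth [y / r]. *)
Lemma slope_near_A {R : realType} (A B : R) (g y t : R -> R) :
  speed_profile A B g -> slope_ode g y t ->
  exists2 K : R, 0 < K & \forall r \near +oo,
    y r <= A + K * r^-1 ^+ 2 /\ t r <= K * r^-1 ^+ 2.
Proof.
move=> hg hy; have A0 := profile_A hg; have B0 := profile_B hg.
have [d d0 [hdA hd]] := profile_linear hg.
(* For [t <= d] the linear upper bound on [g] is inverted; for [t > d] the bound [y - A <= A]
   suffices. *)
have t_ge r : 0 < r -> y r <= 2 * A ->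
    Num.min (2 * B)^-1 (d / A) * (y r - A) <= t r.
  move=> r0 y2A.
  have yA : 0 <= y r - A by rewrite subr_ge0; exact: slope_ge hg hy r0.
  have t0 := ode_t hy r0.
  have [td|dt] := leP (t r) d.
    have /hd/andP[_] : 0 <= t r <= d by rewrite t0.
    rewrite (ode_g hy)// => yt.
    apply: (@le_trans _ _ ((2 * B)^-1 * (y r - A))).
      by rewrite ler_wpM2r// ge_min lexx.
    by rewrite mulrC ler_pdivrMr ?mulr_gt0//; lra.
  apply: (@le_trans _ _ (d / A * (y r - A))).
    by rewrite ler_wpM2r// ge_min lexx orbT.
  apply: le_trans (ltW dt).
  by rewrite mulrAC ler_pdivrMr// ler_pM2l//; lra.
set c := Num.min _ _ in t_ge.
have c0 : 0 < c by rewrite lt_min invr_gt0 divr_gt0// mulr_gt0.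
(* Above the barrier this yields [t r / y >= (2 A + 1) / r], which exceeds [y / r] by at least
   [1 / r]; half of that surplus pays for the barrier's own derivative. *)
pose K := 2 * A * (2 * A + 1) / c.
have K0 : 0 < K by rewrite divr_gt0// !mulr_gt0// ltr_wpDl// mulr_ge0// ltW.
pose D : R -> R := cst A + cst K * GRing.inv ^+ 2 - y.
pose D' r :=
  - 2 * K * r^-1 ^+ 3 - (y r / r - t r * (y r / r + r / y r)).
have dD r : 0 < r -> is_derive (r : R) 1 D (D' r).
  move=> r0; have dx2 := is_deriveX 2 (is_derive_inv r0).
  apply: (is_derive_eq (is_deriveB (is_deriveD
    (is_derive_cst A r 1) (is_deriveM (is_derive_cst K r 1) dx2)) (ode_derive hy r0))).
  rewrite /D' /GRing.scale/= !fctE; have y0 := ode_pos hy r0.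
  by field; rewrite !gt_eqF.
have HD : \forall r \near +oo, 0 <= D r.
  have k0 : 0 < 2^-1 :> R by rewrite invr_gt0.
  apply: (eventually_nonneg (D' := D') k0).
    by near=> r; apply: dD; near: r; exact: pinfty_gt.
  near=> r => Dr.
  have r0 : 0 < r by near: r; exact: pinfty_gt.
  have y0 := ode_pos hy r0.
  have x0 : 0 < r^-1 by rewrite invr_gt0.
  have y2A : y r <= 2 * A by near: r; exact: slope_eventually_le hg hy.
  have x1 : r^-1 < 1 by near: r; exact: pinfty_inv_lt.
  have xK : 4 * K < r by near: r; exact: pinfty_gt.
  have tK : 2 * A * (2 * A + 1) * r^-1 ^+ 2 <= t r.
    apply: le_trans (t_ge _ r0 y2A).
    have -> : 2 * A * (2 * A + 1) = c * K by rewrite /K; field; rewrite gt_eqF.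
    by rewrite -mulrA ler_pM2l//; move: Dr; rewrite /D !fctE; lra.
  have h1 : (2 * A + 1) * r^-1 <= t r * (r / y r).
    rewrite mulrA ler_pdivlMr// -(ler_pM2r x0) mulfK ?gt_eqF//.
    apply: le_trans tK.
    have -> : 2 * A * (2 * A + 1) * r^-1 ^+ 2 =
      (2 * A + 1) * r^-1 * (2 * A) * r^-1 by ring.
    by rewrite ler_pM2r// ler_pM2l// mulr_gt0//; lra.
  have h2 : 0 <= t r * (y r / r) by rewrite !mulr_ge0 ?(ode_t hy)// ltW.
  have h3 : y r / r <= 2 * A * r^-1 by rewrite ler_pM2r.
  rewrite /D'; set x := r^-1 in x0 x1 h1 h2 h3 *.
  have h4 : 4 * K * x ^+ 3 <= x.
    have : 4 * K * x <= 1.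
      by rewrite /x ler_pdivrMr// mul1r ltW.
    move=> h; have -> : 4 * K * x ^+ 3 = (4 * K * x) * x * x by ring.
    rewrite -[leRHS]mul1r ler_pM2r//; apply: le_trans (ltW x1).
    by rewrite -[leRHS]mul1r ler_pM2r.
  by rewrite mulrDr; lra.
have yK : \forall r \near +oo, y r <= A + K * r^-1 ^+ 2.
  near=> r; have : 0 <= D r by near: r.
  by rewrite /D !fctE; lra.
have KB0 : 0 < 2 * K / B by rewrite divr_gt0// mulr_gt0.
exists (K + 2 * K / B); first by rewrite addr_gt0// divr_gt0// mulr_gt0.
near=> r.
have r0 : 0 < r by near: r; exact: pinfty_gt.
have x0 : 0 < r^-1 by rewrite invr_gt0.
have yKr : y r <= A + K * r^-1 ^+ 2 by near: r.
split.
  apply: le_trans yKr _; rewrite lerD2l ler_pM2r ?exprn_gt0//.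
  by rewrite lerDl ltW.
apply: (@le_trans _ _ (2 * K / B * r^-1 ^+ 2)); last first.
  by rewrite ler_pM2r ?exprn_gt0// lerDr ltW.
have s0 : 0 <= 2 * K / B * r^-1 ^+ 2 by rewrite mulr_ge0 ?exprn_ge0 // ltW.
(* At [s = 2 K / (B r^2)] the lower bound [A + B s / 2] on [g] equals the bound [A + K / r^2] on
   [y = g t], so monotonicity gives [t <= s]. *)
apply: (profile_le hg (ode_t hy r0) s0).
rewrite (ode_g hy)//; apply: le_trans yKr _.
have /hd/andP[+ _] : 0 <= 2 * K / B * r^-1 ^+ 2 <= d.
  rewrite s0/= mulrC -ler_pdivlMr//.
  have x1 : r^-1 < 1 by near: r; exact: pinfty_inv_lt.
  have xd : r^-1 < d / (2 * K / B) by near: r; apply: pinfty_inv_lt; exact: divr_gt0.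
  by apply: le_trans (ltW xd); rewrite expr2 -[leRHS]mulr1 ler_pM2l// ltW.
apply: le_trans; rewrite lerD2l.
by rewrite le_eqVlt; apply/orP; left; apply/eqP; field; rewrite !gt_eqF.
Unshelve. all: by end_near.
Qed.

(* E := r^2 (y - A) satisfies r E' = (r^2 / y) (A^2 - E / B) + O(1). *)
Lemma slope_refined {R : realType} (A B : R) (g y t : R -> R) :
  speed_profile A B g -> slope_ode g y t ->
  \forall r \near +oo, `|r ^+ 2 * (y r - A) - A ^+ 2 * B| <= r^-1.
Proof.
move=> hg hy; have A0 := profile_A hg; have B0 := profile_B hg.
have [K K0 hK] := slope_near_A hg hy.
have [d d0 [M hM]] := profile_taylor hg.
pose E : R -> R := id ^+ 2 * (y - cst A).
pose E' r := 2 * r * (y r - A) +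
  r ^+ 2 * (y r / r - t r * (y r / r + r / y r)).
have dE r : 0 < r -> is_derive (r : R) 1 E (E' r).
  move=> r0.
  apply: (is_derive_eq (is_deriveM (is_deriveX 2 (is_derive_id r 1))
    (is_deriveB (ode_derive hy r0) (is_derive_cst A r 1)))).
  rewrite /E' /GRing.scale/= !fctE.
  by have y0 := ode_pos hy r0; field; rewrite !gt_eqF.
(* With [T := t r^2], this bounds the error of replacing [y^2 - T] by [A^2 - E / B], multiplied by
   [r^2]: the first term is from [y^2 - A^2], the second from the Taylor remainder of [g]. *)
pose C := K * (2 * A + K) + `|M| / B * K ^+ 2.
have C0 : 0 <= C.
  by rewrite addr_ge0// !mulr_ge0 ?exprn_ge0 ?invr_ge0 ?addr_ge0 ?mulr_ge0// ltW.
(* At distance [1 / r] from the equilibrium, [r^2 (A^2 - E / B)] already has size [r / B], which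
   beats every bounded term. *)
have rE' : \forall r \near +oo,
    (E r >= A ^+ 2 * B + r^-1 -> r * E' r <= - 2) /\
    (E r <= A ^+ 2 * B - r^-1 -> 2 <= r * E' r).
  near=> r.
  have r0 : 0 < r by near: r; exact: pinfty_gt.
  have x0 : 0 < r^-1 by rewrite invr_gt0.
  have y0 := ode_pos hy r0.
  have t0 := ode_t hy r0.
  have Ay := slope_ge hg hy r0.
  have y2A : y r <= 2 * A by near: r; exact: slope_eventually_le hg hy.
  have x1 : r^-1 < 1 by near: r; exact: pinfty_inv_lt.
  have xd : r^-1 < d / K by near: r; apply: pinfty_inv_lt; exact: divr_gt0.
  (* The factor [2 + 2 K + 2 A K] is the target size 2 plus bounds for [2 E] and [T y]; the [2 A] in
     front accounts for the division by [y]. *)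
  have big : B * (C + 2 * A * (2 + 2 * K + 2 * A * K)) < r.
    by near: r; exact: pinfty_gt.
  have [yK tK] : y r <= A + K * r^-1 ^+ 2 /\ t r <= K * r^-1 ^+ 2.
    by near: r.
  have r2x2 : r^-1 ^+ 2 * r ^+ 2 = 1 by rewrite -exprMn mulVf ?gt_eqF// expr1n.
  have r20 : 0 < r ^+ 2 by rewrite exprn_gt0.
  have r2x1 : r^-1 ^+ 2 <= 1 by rewrite expr_le1// ltW.
  have td : t r <= d.
    apply: le_trans tK _; rewrite mulrC -ler_pdivlMr//.
    by apply: le_trans (ltW xd); rewrite expr2 -[leRHS]mulr1 ler_pM2l// ltW.
  pose e := E r; pose T := t r * r ^+ 2.
  have eE : y r - A = e * r^-1 ^+ 2.
    by rewrite /e /E !fctE mulrAC mulrC; rewrite mulrC -exprMn divff ?gt_eqF// expr1n mul1r.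
  have tE : t r = T * r^-1 ^+ 2 by rewrite /T -mulrA (mulrC (r ^+ 2)) r2x2 mulr1.
  have e0 : 0 <= e by rewrite mulr_ge0 ?subr_ge0// ltW.
  have T0 : 0 <= T by rewrite mulr_ge0// ltW.
  have eK : e <= K.
    by rewrite -(ler_pM2r (exprn_gt0 2 x0)) -eE; lra.
  have TK : T <= K by rewrite -(ler_pM2r (exprn_gt0 2 x0)) -tE.
  have key : `|r ^+ 2 * (y r ^+ 2 - T) - r ^+ 2 * (A ^+ 2 - e / B)| <= C.
    have -> : r ^+ 2 * (y r ^+ 2 - T) - r ^+ 2 * (A ^+ 2 - e / B) =
        e * (2 * A + e * r^-1 ^+ 2)
        + r ^+ 2 * r ^+ 2 / B * (y r - (A + B * t r)).
      have -> : y r = A + e * r^-1 ^+ 2 by rewrite -eE; ring.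
      rewrite tE; move: e T {eE tE e0 T0 eK TK} => e T.
      by field; rewrite !gt_eqF.
    apply: le_trans (ler_normD _ _) _; apply: lerD.
      have ex0 : 0 <= e * r^-1 ^+ 2 by rewrite -eE subr_ge0.
      have Ae0 : 0 <= 2 * A + e * r^-1 ^+ 2 by lra.
      rewrite ger0_norm; last by rewrite mulr_ge0.
      apply: ler_pM => //; rewrite lerD2l -[leRHS]mulr1.
      by apply: ler_pM; rewrite // exprn_ge0 // ltW.
    rewrite normrM ger0_norm ?mulr_ge0 ?invr_ge0 ?(ltW B0) ?exprn_ge0 ?(ltW r0)//.
    have : `|y r - (A + B * t r)| <= `|M| * t r ^+ 2.
      rewrite -(ode_g hy)//; apply: le_trans (hM _ _) _; first by rewrite t0.
      by rewrite ler_wpM2r ?sqr_ge0 ?ler_norm.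
    move=> h.
    apply: (@le_trans _ _ (r ^+ 2 * r ^+ 2 / B * (`|M| * t r ^+ 2))).
      by rewrite ler_wpM2l ?mulr_ge0 ?invr_ge0 ?(ltW B0) ?exprn_ge0 ?(ltW r0).
    have -> : r ^+ 2 * r ^+ 2 / B * (`|M| * t r ^+ 2) = `|M| / B * T ^+ 2.
      by rewrite /T; ring.
    rewrite ler_wpM2l ?divr_ge0 ?(ltW B0)// !expr2.
    by rewrite ler_pM.
  have rEeq : r * E' r = 2 * e - T * y r + r ^+ 2 * (y r ^+ 2 - T) / y r.
    by rewrite /E' /e /E /T !fctE; field; rewrite !gt_eqF.
  have Ty : 0 <= T * y r <= K * (2 * A).
    by rewrite mulr_ge0 ?(ltW y0)//= ler_pM// ltW.
  set N := 2 + 2 * K + 2 * A * K.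
  have N0 : 0 < N by rewrite /N; nra.
  have rB : C + 2 * A * N < r / B by rewrite ltr_pdivlMr// mulrC.
  have Ny : N * y r <= 2 * A * N by rewrite mulrC ler_pM2r.
  move: key; rewrite ler_norml => /andP[key1 key2].
  have rx : r ^+ 2 * (r^-1 / B) = r / B by field; rewrite !gt_eqF.
  split => hE.
    have : r ^+ 2 * (A ^+ 2 - e / B) <= - (r / B).
      have -> : - (r / B) = r ^+ 2 * - (r^-1 / B) by rewrite mulrN rx.
      rewrite ler_pM2l//; suff : A ^+ 2 + r^-1 / B <= e / B by lra.
      by rewrite ler_pdivlMr// mulrDl divfK ?gt_eqF.
    move=> h.
    have : r ^+ 2 * (y r ^+ 2 - T) / y r <= - N.
      by rewrite ler_pdivrMr// mulNr; lra.
    by rewrite rEeq /N; nra.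
  have : r / B <= r ^+ 2 * (A ^+ 2 - e / B).
    rewrite -rx ler_pM2l//; suff : e / B <= A ^+ 2 - r^-1 / B by lra.
    by rewrite ler_pdivrMr// mulrBl divfK ?gt_eqF.
  move=> h.
  have : N <= r ^+ 2 * (y r ^+ 2 - T) / y r.
    by rewrite ler_pdivlMr//; lra.
  by rewrite rEeq /N; nra.
have k1 : 0 < 1 :> R by [].
(* The barriers are [A^2 B + 1 / r] here and [A^2 B - 1 / r] next. Their derivatives cost less than
   [1 / r], so the rate [2 / r] of [E] leaves [k = 1]. *)
have h1 : \forall r \near +oo, 0 <= (cst (A ^+ 2 * B) + GRing.inv - E) r.
  apply: (eventually_nonneg (D' := fun r => - r^-1 ^+ 2 - E' r) k1).
    near=> r; have r0 : 0 < r by near: r; exact: pinfty_gt.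
    apply: (is_derive_eq (is_deriveB (is_deriveD
      (is_derive_cst (A ^+ 2 * B) r 1) (is_derive_inv r0)) (dE _ r0))).
    by rewrite add0r.
  near=> r; rewrite !fctE => Dr.
  have r0 : 0 < r by near: r; exact: pinfty_gt.
  have x1 : r^-1 < 1 by near: r; exact: pinfty_inv_lt.
  have [+ _] : (E r >= A ^+ 2 * B + r^-1 -> r * E' r <= - 2) /\
    (E r <= A ^+ 2 * B - r^-1 -> 2 <= r * E' r) by near: r.
  rewrite -subr_le0 => /(_ Dr) h.
  have rx : r^-1 ^+ 2 * r = r^-1 by field; rewrite gt_eqF.
  by rewrite ler_pdivrMr// mulrBl mulNr rx; lra.
have h2 : \forall r \near +oo, 0 <= (E - cst (A ^+ 2 * B) + GRing.inv) r.
  apply: (eventually_nonneg (D' := fun r => E' r - r^-1 ^+ 2) k1).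
    near=> r; have r0 : 0 < r by near: r; exact: pinfty_gt.
    apply: (is_derive_eq (is_deriveD (is_deriveB (dE _ r0)
      (is_derive_cst (A ^+ 2 * B) r 1)) (is_derive_inv r0))).
    by rewrite subr0.
  near=> r; rewrite !fctE => Dr.
  have r0 : 0 < r by near: r; exact: pinfty_gt.
  have x1 : r^-1 < 1 by near: r; exact: pinfty_inv_lt.
  have [_ +] : (E r >= A ^+ 2 * B + r^-1 -> r * E' r <= - 2) /\
    (E r <= A ^+ 2 * B - r^-1 -> 2 <= r * E' r) by near: r.
  have hE : E r <= A ^+ 2 * B - r^-1 by lra.
  move=> /(_ hE) h.
  have rx : r^-1 ^+ 2 * r = r^-1 by field; rewrite gt_eqF.
  by rewrite ler_pdivrMr// mulrBl rx; lra.
near=> r.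
have : 0 <= (cst (A ^+ 2 * B) + GRing.inv - E) r by near: r.
have : 0 <= (E - cst (A ^+ 2 * B) + GRing.inv) r by near: r.
by rewrite !fctE /E !fctE => *; rewrite ler_norml; apply/andP; split; lra.
Unshelve. all: by end_near.
Qed.

(** The error is exactly [1 / (r A y)] times the residual of [slope_refined] plus [A B (y - A)].
    Both are [O(1 / r)], and [A y >= A^2]. *)
Lemma slope_asymptotics {R : realType} (A B : R) (g y t : R -> R) :
  speed_profile A B g -> slope_ode g y t ->
  exists2 C : R, 0 <= C & \forall r \near +oo,
    `|r / y r - (r / A - B / r)| <= C * r^-1 ^+ 2.
Proof.
move=> hg hy; have A0 := profile_A hg; have B0 := profile_B hg.
have [K K0 hK] := slope_near_A hg hy.
have hE := slope_refined hg hy.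
exists ((1 + A * B * K) / A ^+ 2).
  by rewrite divr_ge0 ?exprn_ge0 ?addr_ge0 ?mulr_ge0// ltW.
near=> r.
have r0 : 0 < r by near: r; exact: pinfty_gt.
have x0 : 0 < r^-1 by rewrite invr_gt0.
have y0 := ode_pos hy r0.
have Ay := slope_ge hg hy r0.
have x1 : r^-1 < 1 by near: r; exact: pinfty_inv_lt.
have [yK _] : y r <= A + K * r^-1 ^+ 2 /\ t r <= K * r^-1 ^+ 2 by near: r.
have e1 : `|r ^+ 2 * (y r - A) - A ^+ 2 * B| <= r^-1 by near: r.
have -> : r / y r - (r / A - B / r) =
    r^-1 * ((A ^+ 2 * B - r ^+ 2 * (y r - A)) + A * B * (y r - A)) / (A * y r).
  by field; rewrite !gt_eqF.
rewrite normrM (ger0_norm (_ : 0 <= (A * y r)^-1)); last first.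
  by rewrite invr_ge0 mulr_ge0// ltW.
rewrite ler_pdivrMr ?mulr_gt0// normrM (ger0_norm (ltW x0)).
have -> : (1 + A * B * K) / A ^+ 2 * r^-1 ^+ 2 * (A * y r) =
    r^-1 * ((1 + A * B * K) * r^-1 * (y r / A)).
  by field; rewrite !gt_eqF.
rewrite ler_pM2l//.
have yA : 1 <= y r / A by rewrite ler_pdivlMr// mul1r.
have ABK : 0 <= (1 + A * B * K) * r^-1.
  by rewrite mulr_ge0 ?addr_ge0 ?mulr_ge0// ltW.
apply: (@le_trans _ _ ((1 + A * B * K) * r^-1)); last first.
  by rewrite -[leLHS]mulr1 ler_wpM2l.
apply: le_trans (ler_normD _ _) _; rewrite distrC mulrDl mul1r; apply: lerD => //.
rewrite ger0_norm; last by rewrite !mulr_ge0 ?subr_ge0// ltW.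
rewrite -[leRHS]mulrA ler_pM2l ?mulr_gt0//.
apply: (@le_trans _ _ (K * r^-1 ^+ 2)); first by lra.
by rewrite ler_pM2l// expr2 -[leRHS]mulr1 ler_pM2l// ltW.
Unshelve. all: by end_near.
Qed.

(** * Integration of the slope *)

Lemma le_of_derive_ge0 {R : realType} (F F' : R -> R) (a b : R) : a <= b ->
  (forall s, a <= s -> is_derive s 1 F (F' s)) ->
  (forall s, a <= s -> 0 <= F' s) -> F a <= F b.
Proof.
move=> ab dF F'0.
have d s : s \in `]a, b[ -> is_derive s 1 F (F' s).
  by rewrite in_itv/= => /andP[/ltW + _]; exact: dF.
have c : {within `[a, b], continuous F}.
  apply: derivable_within_continuous => s.
  by rewrite in_itv/= => /andP[/dF[]].
have [s] := MVT_segment ab d c.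
rewrite in_itv/= => /andP[as_ _] h.
by rewrite -subr_ge0 h mulr_ge0 ?subr_ge0// F'0.
Qed.

(** [F - C / r] is nondecreasing and [F + C / r] nonincreasing, so every value of the former lies
    below every value of the latter. The supremum of the former separates them, and [c] is its
    opposite. *)
Lemma integrate_inv_sqr {R : realType} (F F' : R -> R) (C : R) :
  (\forall r \near +oo, is_derive (r : R) 1 F (F' r)) ->
  (\forall r \near +oo, `|F' r| <= C * r^-1 ^+ 2) ->
  exists c : R, \forall r \near +oo, `|F r + c| <= C * r^-1.
Proof.
move=> dF hF; have /= [M [_ HM]] := filterI dF hF.
pose r0 := Num.max 1 (M + 1).
have r0_gt0 : 0 < r0 by rewrite lt_max ltr01.
have {dF hF HM}HM r : r0 <= r ->
    is_derive r 1 F (F' r) /\ - (C * r^-1 ^+ 2) <= F' r <= C * r^-1 ^+ 2.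
  rewrite -ler_norml => rr; apply: HM; apply: lt_le_trans rr.
  by rewrite lt_max ltrDl ltr01 orbT.
have pos r : r0 <= r -> 0 < r by apply: lt_le_trans.
have dx (k : R) r : r0 <= r ->
    is_derive r 1 (cst k * GRing.inv) (- (k * r^-1 ^+ 2)).
  move=> /pos r_gt0.
  apply: (is_derive_eq (is_deriveM (is_derive_cst k r 1) (is_derive_inv r_gt0))).
  by rewrite /GRing.scale/= mulr0 addr0 mulrN.
have up a b : r0 <= a -> a <= b -> F a - C * a^-1 <= F b - C * b^-1.
  move=> ra ab.
  pose F1 : R -> R := F - cst C * GRing.inv.
  apply: (@le_of_derive_ge0 _ F1 (fun s => F' s - - (C * s^-1 ^+ 2)) a b ab).
    move=> s /(le_trans ra) rs.
    exact: (is_deriveB (HM _ rs).1 (dx C _ rs)).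
  by move=> s /(le_trans ra)/HM[_ /andP[+ _]]; lra.
have down a b : r0 <= a -> a <= b -> F b + C * b^-1 <= F a + C * a^-1.
  move=> ra ab; rewrite -lerN2 !opprD.
  pose F1 : R -> R := - F - cst C * GRing.inv.
  apply: (@le_of_derive_ge0 _ F1 (fun s => - F' s - - (C * s^-1 ^+ 2)) a b ab).
    move=> s /(le_trans ra) rs.
    exact: (is_deriveB (is_deriveN (HM _ rs).1) (dx C _ rs)).
  by move=> s /(le_trans ra)/HM[_ /andP[_ +]]; lra.
have C0 : 0 <= C.
  have [_ h] := HM _ (lexx r0).
  have : 0 <= C * r0^-1 ^+ 2 by lra.
  by rewrite pmulr_lge0// exprn_gt0// invr_gt0.
have cross a b : r0 <= a -> r0 <= b -> F a - C * a^-1 <= F b + C * b^-1.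
  move=> ra rb; have Ca : 0 <= C * a^-1 by rewrite mulr_ge0// invr_ge0 ltW// pos.
  have Cb : 0 <= C * b^-1 by rewrite mulr_ge0// invr_ge0 ltW// pos.
  have [ab|/ltW ba] := leP a b; first by have := up _ _ ra ab; lra.
  by have := down _ _ rb ba; lra.
pose S := [set F s - C * s^-1 | s in [set s | r0 <= s]].
have S0 : S !=set0 by exists (F r0 - C * r0^-1), r0 => //=.
have ubS r : r0 <= r -> ubound S (F r + C * r^-1).
  by move=> rr _ [s /= rs <-]; exact: cross.
exists (- sup S); near=> r.
have rr : r0 <= r by near: r; apply: nbhs_pinfty_ge; exact: num_real.
have h1 : sup S <= F r + C * r^-1 by apply: ge_sup => //; exact: ubS.
have h2 : F r - C * r^-1 <= sup S.
  by apply: ub_le_sup; [exists (F r0 + C * r0^-1); exact: ubS | exists r].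
by rewrite ler_norml; apply/andP; split; lra.
Unshelve. all: by end_near.
Qed.

Lemma profile_asymptotics {R : realType} (A B : R) (g y t phi : R -> R) :
  speed_profile A B g -> slope_ode g y t ->
  (forall r : R, 0 < r -> is_derive r 1 phi (r / y r)) ->
  exists c C : R, \forall r \near +oo,
    `|phi r + c - (r ^+ 2 / (2 * A) - B * ln r)| <= C * r^-1.
Proof.
move=> hg hy dphi; have A0 := profile_A hg.
have [C _ hC] := slope_asymptotics hg hy.
pose F : R -> R := phi - (cst (2 * A)^-1 * id ^+ 2 - cst B * @ln R).
have dF : \forall r \near +oo, is_derive (r : R) 1 F (r / y r - (r / A - B / r)).
  near=> r; have r0 : 0 < r by near: r; exact: pinfty_gt.
  apply: (is_derive_eq (is_deriveB (dphi _ r0) (is_deriveB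
    (is_deriveM (is_derive_cst (2 * A)^-1 r 1) (is_deriveX 2 (is_derive_id r 1)))
    (is_deriveM (is_derive_cst B r 1) (is_derive1_ln r0))))).
  rewrite /GRing.scale/= !mulr0 !addr0.
  by have y0 := ode_pos hy r0; field; rewrite !gt_eqF.
have [c hc] := integrate_inv_sqr dF hC.
exists c, C; near=> r.
have -> : phi r + c - (r ^+ 2 / (2 * A) - B * ln r) = F r + c.
  by rewrite /F !fctE; ring.
by near: r.
Unshelve. all: by end_near.
Qed.

(** * The speed along the ray (s, e) *)

(** The two derivatives are limits of the same difference quotients. This and the converse
    [derive_of_line] reduce partial derivatives to one-variable calculus. *)
Lemma is_derive_line {R : realType} {n : nat} (h : 'rV[R]_n -> R)
    (v w : 'rV[R]_n) (s : R) :
  derivable h (s *: v + w) v ->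
  is_derive s 1 (fun s => h (s *: v + w)) ('D_v h (s *: v + w)).
Proof.
have E : (fun t : R => t^-1 *: (((fun s => h (s *: v + w)) \o shift s) (t *: 1)
            - h (s *: v + w))) =
         (fun t => t^-1 *: ((h \o shift (s *: v + w)) (t *: v) - h (s *: v + w))).
  apply/funext => t /=; congr (_ *: (h _ - _)).
  by rewrite -[t *: 1]/(t * 1) mulr1 scalerDl addrA.
by move=> hv; split; rewrite /derivable /derive E.
Qed.

Lemma derive_of_line {R : realType} {n : nat} (h : 'rV[R]_n -> R)
    (v w : 'rV[R]_n) (d : R) :
  is_derive (0 : R) 1 (fun s => h (s *: v + w)) d -> 'D_v h w = d.
Proof.
move=> [_ <-]; rewrite /derive; congr (lim (_ @ 0^')).
apply/funext => t /=; congr (_ *: (h _ - h _)).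
  by rewrite -[t *: 1]/(t * 1) mulr1 addr0.
by rewrite scale0r add0r.
Qed.

(** For [s > 0] all entries are positive; the endpoint [s = 0] is nondegeneracy. *)
Lemma speed_ray {R : realType} {n : nat} (i0 : 'I_n) (Gam : set 'rV[R]_n)
    (f : 'rV[R]_n -> R) (s : R) : i0 = 0%N :> nat ->
  speed_function Gam f -> nondegenerate_speed Gam f ->
  0 <= s -> Gam (s *: delta_mx 0 i0 + zero_e R n).
Proof.
move=> i00 hf hnd; rewrite le_eqVlt => /predU1P[<-|s0]; first by rewrite scale0r add0r; case: hnd.
apply: (speed_pos_cone hf) => i; rewrite !mxE eqxx /=.
have [->|ii0] := eqVneq i i0; first by rewrite mulr1 i00 addr0.
suff -> : (0 < i)%N by rewrite mulr0 add0r ltr01.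
by rewrite lt0n; apply: contra_neq ii0 => i0_; apply: val_inj; rewrite /= i0_ i00.
Qed.

Lemma MVT_nonneg {R : realType} (k k' : R -> R) (a b : R) :
  (forall s : R, 0 <= s -> is_derive s 1 k (k' s)) -> 0 <= a -> a < b ->
  exists2 c, a < c < b & k b - k a = k' c * (b - a).
Proof.
move=> dk a0 ab.
have d s : s \in `]a, b[ -> is_derive s 1 k (k' s).
  by rewrite in_itv/= => /andP[/ltW/(le_trans a0)/dk].
have c : {within `[a, b], continuous k}.
  apply: derivable_within_continuous => s.
  by rewrite in_itv/= => /andP[/(le_trans a0)/dk[]].
have [s] := MVT ab d c.
by rewrite in_itv/= => ? ?; exists s.
Qed.

(** Monotonicity comes from the positive first partial derivative, the Taylor bound from continuity
    of the second one at [(0, e)]. *)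
Lemma speed_profile_ray {R : realType} {n : nat} (i0 : 'I_n)
    (Gam : set 'rV[R]_n) (f : 'rV[R]_n -> R) : i0 = 0%N :> nat ->
  speed_function Gam f -> nondegenerate_speed Gam f ->
  speed_profile (f (zero_e R n)) (partial i0 f (zero_e R n))
    (fun s => f (s *: delta_mx 0 i0 + zero_e R n)).
Proof.
move=> i00 hf hnd.
pose ray (s : R) : 'rV[R]_n := s *: delta_mx 0 i0 + zero_e R n.
have ray_in (s : R) : 0 <= s -> Gam (ray s) by exact: speed_ray hf hnd.
have ray0 : ray 0 = zero_e R n by rewrite /ray scale0r add0r.
pose z := zero_e R n.
have [z_in fz] := hnd.
have [_ /(_ i0)[df [_ /(_ i0)[ddf [cddf _]]]]] := speed_smooth hf 2.
pose g1 s := partial i0 f (ray s).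
pose g2 s := partial i0 (partial i0 f) (ray s).
have dg s : 0 <= s -> is_derive (s : R) 1 (fun s => f (ray s)) (g1 s).
  by move=> s0; apply: is_derive_line; apply: df; exact: ray_in.
have dg1 s : 0 <= s -> is_derive (s : R) 1 g1 (g2 s).
  by move=> s0; apply: is_derive_line; apply: ddf; exact: ray_in.
split.
- exact: fz.
- exact: (speed_mono hf).
- move=> s s' s0 ss'; have [c /andP[sc _] e] := MVT_nonneg dg s0 ss'.
  rewrite -subr_gt0 e mulr_gt0 ?subr_gt0//; apply: (speed_mono hf).
  by apply: ray_in; rewrite (le_trans s0)// ltW.
- pose M := `|g2 0| + 1.
  have c2 : {for 0, continuous g2}.
    apply: (@continuous_comp _ _ _ (fun s : R => ray s)).
      by apply: cvgD; [apply: cvgZl; exact: cvg_id | exact: cvg_cst].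
    by apply: cddf; exact: ray_in.
  have : \forall s \near (0 : R), `|g2 s| < M.
    have cn : {for 0, continuous (fun s => `|g2 s|)}.
      by apply: (@continuous_comp _ _ _ g2) => //; exact: norm_continuous.
    by apply: (cvgr_lt _ cn); rewrite ltrDl.
  move=> /nbhs_ballP[e /= e0_gt0 he].
  exists (e / 2); first by rewrite divr_gt0.
  exists M => s /andP[]; rewrite le_eqVlt => /predU1P[<- _|s0 se].
    by rewrite -/(ray 0) ray0 mulr0 addr0 subrr normr0 expr0n mulr0.
  (* The mean value theorem for [k], then for [g1], writes the remainder as [g2 b * c * s] with
     [0 < b < c < s]. *)
  pose k s := f (ray s) - g1 0 * s.
  have dk r : 0 <= r -> is_derive (r : R) 1 k (g1 r - g1 0).
    move=> r0; apply: (is_derive_eq (is_deriveB (dg r r0)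
      (is_deriveM (is_derive_cst (g1 0) r 1) (is_derive_id r 1)))).
    by rewrite /GRing.scale/= mulr0 mulr1 addr0.
  have [c /andP[c0 cs] kE] := MVT_nonneg dk (lexx 0) s0.
  have [b /andP[b0 bc] gE] := MVT_nonneg dg1 (lexx 0) c0.
  have -> : f (ray s) - (f z + partial i0 f z * s) = (g2 b * c) * s.
    move: kE; rewrite gE !subr0 => <-.
    by rewrite /k /g1 ray0 mulr0; ring.
  have gb : `|g2 b| <= M.
    apply/ltW/he; rewrite /ball/= sub0r normrN gtr0_norm//.
    by rewrite (lt_trans bc)// (lt_le_trans cs)// (le_trans se)// ler_pdivrMr//; lra.
  rewrite !normrM (gtr0_norm c0) (gtr0_norm s0) expr2 mulrA ler_pM2r//.
  by apply: ler_pM => //; exact: ltW.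
- by rewrite scale0r add0r.
Qed.

(** * Rotationally symmetric graphs *)

Lemma enorm_ge0 {R : realType} {n : nat} (x : 'rV[R]_n) : 0 <= enorm x.
Proof. exact: sqrtr_ge0. Qed.

Lemma enorm_sqr {R : realType} {n : nat} (x : 'rV[R]_n) :
  enorm x ^+ 2 = \sum_(i < n) x 0 i ^+ 2.
Proof. by rewrite sqr_sqrtr// sumr_ge0// => i _; exact: sqr_ge0. Qed.

Lemma coord_le_enorm {R : realType} {n : nat} (x : 'rV[R]_n) (i : 'I_n) :
  x 0 i <= enorm x.
Proof.
rewrite (le_trans (ler_norm _))// -sqrtr_sqr ler_wsqrtr// (bigD1 i)//= lerDl.
by rewrite sumr_ge0// => j _; exact: sqr_ge0.
Qed.

Lemma enorm_line_sqr {R : realType} {n : nat} (x : 'rV[R]_n) (j : 'I_n) (s : R) :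
  enorm (s *: delta_mx 0 j + x) ^+ 2 = enorm x ^+ 2 + 2 * s * x 0 j + s ^+ 2.
Proof.
rewrite !enorm_sqr (bigD1 j)//= [in RHS](bigD1 j)//= !mxE !eqxx /= mulr1.
rewrite (eq_bigr (fun i => x 0 i ^+ 2)) => [|i ij].
  by ring.
by rewrite !mxE eqxx/= (negPf ij) mulr0 add0r.
Qed.

Lemma enorm_axis {R : realType} {n : nat} (i : 'I_n) (r : R) :
  enorm (r *: delta_mx 0 i : 'rV[R]_n) = `|r|.
Proof.
rewrite /enorm (bigD1 i)//= big1 => [|j ji]; last first.
  by rewrite !mxE eqxx/= (negPf ji) mulr0 expr0n.
by rewrite !mxE !eqxx mulr1 addr0 sqrtr_sqr.
Qed.

(** Along a coordinate line the squared norm is a quadratic polynomial, positive at 0, so the chain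
    rule for the square root applies. *)
Lemma is_derive_enorm {R : realType} {n : nat} (x : 'rV[R]_n) (j : 'I_n) :
  0 < enorm x ->
  is_derive (0 : R) 1 (fun s => enorm (s *: delta_mx 0 j + x)) (x 0 j / enorm x).
Proof.
move=> x0.
pose q : R -> R := cst (enorm x ^+ 2) + cst (2 * x 0 j) * id + id ^+ 2.
have -> : (fun s => enorm (s *: delta_mx 0 j + x)) = Num.sqrt \o q.
  apply/funext => s /=; rewrite -[LHS]ger0_norm ?enorm_ge0// -sqrtr_sqr.
  by rewrite enorm_line_sqr; congr Num.sqrt; rewrite /q !fctE; ring.
have q0 : q 0 = enorm x ^+ 2 by rewrite /q !fctE; ring.
have dq : is_derive (0 : R) 1 q (2 * x 0 j).
  apply: (is_derive_eq (is_deriveD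
    (is_deriveD (is_derive_cst (enorm x ^+ 2) (0 : R) 1)
      (is_deriveM (is_derive_cst (2 * x 0 j) (0 : R) 1) (is_derive_id (0 : R) 1)))
    (is_deriveX 2 (is_derive_id (0 : R) 1)))).
  by rewrite /GRing.scale/=; ring.
have ds : is_derive (q 0) 1 (@Num.sqrt R) (2 * Num.sqrt (q 0))^-1.
  by apply: is_derive1_sqrt; rewrite q0 exprn_gt0.
apply: (is_derive_eq (is_derive1_comp ds dq)).
rewrite q0 sqrtr_sqr ger0_norm ?enorm_ge0//.
by field; rewrite gt_eqF.
Qed.

Lemma is_derive_axis {R : realType} {n : nat} (h : 'rV[R]_n -> R) (i : 'I_n)
    (r : R) : derivable h (r *: delta_mx 0 i) (delta_mx 0 i) ->
  is_derive r 1 (fun s => h (s *: delta_mx 0 i)) (partial i h (r *: delta_mx 0 i)).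
Proof.
have E : (fun s : R => h (s *: delta_mx 0 i)) =
         (fun s : R => h (s *: delta_mx 0 i + 0)).
  by apply/funext => s; rewrite addr0.
rewrite E -[r *: _]addr0; exact: is_derive_line.
Qed.

Section radial.
Context {R : realType} {n : nat} (i0 : 'I_n) (u : 'rV[R]_n -> R)
  (u_C2 : class_C setT 2 u) (u_rot : rotationally_symmetric u).
Local Notation e0 := (delta_mx 0 i0 : 'rV[R]_n).
Local Notation p r := (partial i0 u (r *: e0)).
Local Notation q r := (partial i0 (partial i0 u) (r *: e0)).

Lemma radial_profile (x : 'rV[R]_n) : u x = u (enorm x *: e0).
Proof. by apply: u_rot; rewrite enorm_axis ger0_norm ?enorm_ge0. Qed.

Lemma is_derive_profile (r : R) : is_derive r 1 (fun s => u (s *: e0)) (p r).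
Proof. by case: u_C2 => _ /(_ i0)[du _]; apply: is_derive_axis; exact: du. Qed.

Lemma is_derive_slope (r : R) : is_derive r 1 (fun s => p s) (q r).
Proof.
case: u_C2 => _ /(_ i0)[_ [_ /(_ i0)[ddu _]]].
by apply: is_derive_axis; exact: ddu.
Qed.

Lemma partial_radial (j : 'I_n) (x : 'rV[R]_n) : 0 < enorm x ->
  partial j u x = p (enorm x) * (x 0 j / enorm x).
Proof.
move=> x0; apply: derive_of_line.
have -> : (fun s : R => u (s *: delta_mx 0 j + x)) =
    (fun s => u (s *: e0)) \o (fun s => enorm (s *: delta_mx 0 j + x)).
  by apply/funext => s /=; rewrite radial_profile.
have := is_derive_enorm j x0; set rho := (fun s : R => enorm _) => drho.
have rho0 : rho 0 = enorm x by rewrite /rho scale0r add0r.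
by apply: is_derive1_comp drho; rewrite rho0; exact: is_derive_profile.
Qed.

Lemma axis_coord (r : R) (j : 'I_n) : (r *: e0) 0 j = r *+ (j == i0).
Proof. by rewrite !mxE eqxx/= mulr_natr. Qed.

(** Differentiating [partial_radial] once more requires it on a neighbourhood; for [|s| < r] the
    coordinate along [i0] stays positive. *)
Lemma near_enorm_axis_gt0 (r : R) (j : 'I_n) : 0 < r ->
  \forall s \near (0 : R), 0 < enorm (s *: delta_mx 0 j + r *: e0).
Proof.
move=> r0; apply/nbhs_ballP; exists r => //= s; rewrite /ball/= sub0r normrN => sr.
apply: lt_le_trans (coord_le_enorm _ i0).
rewrite mxE axis_coord eqxx/= !mxE eqxx /=.
have := ler_norm (- s); rewrite normrN => h.
by case: (i0 == j); rewrite ?mulr1 ?mulr0; lra.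
Qed.

(** Moving in direction [i] keeps the [j]-th coordinate at 0, and the radial formula for
    [partial j u] has it as a factor. *)
Lemma hessian_offdiag (r : R) (i j : 'I_n) : 0 < r -> j != i0 -> i != j ->
  partial i (partial j u) (r *: e0) = 0.
Proof.
move=> r0 ji0 ij; apply: derive_of_line.
apply: near_eq_is_derive (is_derive_cst (0 : R) (0 : R) 1).
near=> s; have s0 : 0 < enorm (s *: delta_mx 0 i + r *: e0).
  by near: s; exact: near_enorm_axis_gt0.
rewrite partial_radial// mxE axis_coord (negPf ji0) addr0 !mxE.
by rewrite eq_sym (negPf ij) andbF mulr0 mul0r mulr0.
Unshelve. all: by end_near.
Qed.

(** Along the line [partial j u] is [p(rho) * (s / rho)]; at [s = 0] only the derivative of the
    factor [s] survives. *)
Lemma hessian_diag (r : R) (j : 'I_n) : 0 < r -> j != i0 ->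
  partial j (partial j u) (r *: e0) = p r / r.
Proof.
move=> r0 ji0; apply: derive_of_line.
have x0 : 0 < enorm (r *: e0) by rewrite enorm_axis normr_gt0 gt_eqF.
have := is_derive_enorm j x0; set rho := (fun s : R => enorm _) => drho.
have rho0 : rho 0 = r by rewrite /rho scale0r add0r enorm_axis gtr0_norm.
have rho0N : rho 0 != 0 by rewrite rho0 gt_eqF.
have dp : is_derive (rho 0) 1 (fun s => p s) (q r) by rewrite rho0; exact: is_derive_slope.
have dprho := is_derive1_comp dp drho.
apply: (@near_eq_is_derive _ _ _ (((fun s => p s) \o rho) * (id * (fun s => (rho s)^-1)))).
  near=> s; have s0 : 0 < enorm (s *: delta_mx 0 j + r *: e0).
    by near: s; exact: near_enorm_axis_gt0.
  rewrite partial_radial// mxE axis_coord (negPf ji0) addr0 !mxE !eqxx mulr1.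
  by rewrite !fctE.
apply: (is_derive_eq (is_deriveM dprho
  (is_deriveM (is_derive_id (0 : R) 1) (is_deriveV rho0N drho)))).
rewrite /GRing.scale/= !fctE rho0.
by rewrite !(mul0r, mulr0, add0r, addr0, mulr1).
Unshelve. all: by end_near.
Qed.

End radial.

(** * Convexity and the translator equation of a bowl *)

Lemma invmx_diag {F : fieldType} {n : nat} (d : 'rV[F]_n) :
  (forall i, d 0 i != 0) -> invmx (diag_mx d) = diag_mx (\row_i (d 0 i)^-1).
Proof.
move=> d0; have dK : diag_mx d *m diag_mx (\row_i (d 0 i)^-1) = 1%:M.
  rewrite mulmx_diag -diag_const_mx; congr diag_mx.
  by apply/rowP => i; rewrite !mxE divff.
have [dU _] := mulmx1_unit dK.
by rewrite -[RHS](mulKmx dU) dK mulmx1.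
Qed.

(** By convexity the difference quotients from [a] towards [b] are at most [phi b - phi a]; their
    limit is [d * (b - a)]. *)
Lemma tangent_le_of_convex {R : realType} (phi : R -> R) (a b d : R) :
  (forall t, 0 < t -> t < 1 ->
    phi (t * b + (1 - t) * a) <= t * phi b + (1 - t) * phi a) ->
  is_derive a 1 phi d -> phi a + d * (b - a) <= phi b.
Proof.
move=> cvx dphi.
pose l : R -> R := id * cst (b - a) + cst a.
have l0 : l 0 = a by rewrite /l !fctE mul0r add0r.
have dl : is_derive (0 : R) 1 l (b - a).
  apply: (is_derive_eq (is_deriveD (is_deriveM (is_derive_id (0 : R) 1)
    (is_derive_cst (b - a) (0 : R) 1)) (is_derive_cst a (0 : R) 1))).
  by rewrite /GRing.scale/= mulr0 add0r mulr1 addr0.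
have dphil : is_derive (l 0) 1 phi d by rewrite l0.
have [dk dkE] := is_derive1_comp dphil dl.
move: dk; rewrite /derivable => /cvg_dnbhs_at_right.
rewrite -/(derive _ _ _) dkE => dk.
rewrite addrC -lerBrDr; apply: (cvgr_to_le dk).
near=> t.
have t0 : 0 < t by near: t; exact: nbhs_right_gt.
have t1 : t < 1 by near: t; exact: nbhs_right_lt.
rewrite -[X in X <= _]/(t^-1 * (phi (l (t * 1 + 0)) - phi (l 0))) mulr1 addr0 l0.
rewrite mulrC ler_pdivrMr//.
have -> : l t = t * b + (1 - t) * a by rewrite /l !fctE; ring.
by have := cvx t t0 t1; lra.
Unshelve. all: by end_near.
Qed.

Section bowl.
Context {R : realType} {n : nat} (i0 : 'I_n) (i00 : i0 = 0%N :> nat)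
  (Gam : set 'rV[R]_n) (f u : 'rV[R]_n -> R)
  (hf : speed_function Gam f) (hnd : nondegenerate_speed Gam f)
  (hu : entire_bowl Gam f u).
Local Notation e0 := (delta_mx 0 i0 : 'rV[R]_n).
Local Notation phi r := (u (r *: e0)).
Local Notation p r := (partial i0 u (r *: e0)).
Local Notation q r := (partial i0 (partial i0 u) (r *: e0)).
Let u_C2 := bowl_C2 hu.
Let u_rot := bowl_rotationally_symmetric hu.

Lemma profile_strictly_convex (a b t : R) : a != b -> 0 < t -> t < 1 ->
  phi (t * b + (1 - t) * a) < t * phi b + (1 - t) * phi a.
Proof.
move=> ab t0 t1; rewrite /= scalerDl -!scalerA.
apply: (bowl_strictly_convex hu) => //; apply: contra_neq ab => /rowP/(_ i0).
by rewrite !axis_coord eqxx.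
Qed.

Lemma profile_tangent (a b : R) : phi a + p a * (b - a) <= phi b.
Proof.
have [->|ab] := eqVneq a b; first by rewrite subrr mulr0 addr0.
apply: (tangent_le_of_convex (phi := fun r => phi r)); last exact: is_derive_profile.
by move=> t t0 t1; apply/ltW/profile_strictly_convex.
Qed.

(** The profile is even and strictly convex, so [phi 0 < phi r]; the tangent at [r], evaluated at 0,
    then gives [p r * r > 0]. *)
Lemma slope_gt0 (r : R) : 0 < r -> 0 < p r.
Proof.
move=> r0; have h1 := profile_tangent r 0.
have rN : r != - r by rewrite -subr_eq0 opprK gt_eqF// addr_gt0.
have h2 : phi 0 < phi r.
  have half : 0 < 2^-1 :> R by rewrite invr_gt0.
  have half1 : 2^-1 < 1 :> R by rewrite invf_lt1// ltr1n.
  have := profile_strictly_convex rN half half1.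
  have -> : 2^-1 * - r + (1 - 2^-1) * r = 0 by field.
  have -> : phi (- r) = phi r by apply: u_rot; rewrite !enorm_axis normrN.
  by move/lt_le_trans; apply; rewrite le_eqVlt; apply/orP; left; apply/eqP; field.
have : 0 < p r * r by lra.
by rewrite pmulr_lgt0.
Qed.

Lemma slope_nondecreasing (a b : R) : a <= b -> p a <= p b.
Proof.
rewrite le_eqVlt => /predU1P[->//|ab].
have := profile_tangent a b; have := profile_tangent b a => h1 h2.
have : 0 <= (p b - p a) * (b - a) by lra.
by rewrite pmulr_lge0 ?subr_gt0// subr_ge0.
Qed.

Lemma slope_derive_ge0 (r : R) : 0 <= q r.
Proof.
have [dk <-] := is_derive_slope i0 u_C2 r.
move: (dk); rewrite /derivable => /cvg_dnbhs_at_right.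
rewrite -/(derive _ _ _) => {}dk.
apply: (cvgr_to_ge dk); near=> t.
have t0 : 0 < t by near: t; exact: nbhs_right_gt.
rewrite -[X in _ <= X]/(t^-1 * (p (t * 1 + r) - p r)).
rewrite mulr_ge0 ?invr_ge0 ?(ltW t0)// subr_ge0 slope_nondecreasing//.
by rewrite mulr1 lerDr ltW.
Unshelve. all: by end_near.
Qed.

Lemma grad_axis (r : R) : 0 < r -> grad u (r *: e0) = p r *: e0.
Proof.
move=> r0; apply/rowP => j.
rewrite mxE (partial_radial i0)// enorm_axis gtr0_norm// axis_coord axis_coord.
by case: eqP => _; rewrite ?mulr1n ?mulr0n ?mul0r ?mulr0// divff ?mulr1// gt_eqF.
Qed.

Lemma area_factor_axis (r : R) : 0 < r ->
  area_factor u (r *: e0) = Num.sqrt (1 + p r ^+ 2).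
Proof.
by move=> r0; rewrite /area_factor grad_axis// enorm_axis real_normK// num_real.
Qed.

Lemma first_form_axis (r : R) : 0 < r -> first_form u (r *: e0) =
  diag_mx (\row_i (1 + p r ^+ 2 *+ (i == i0))).
Proof.
move=> r0; apply/matrixP => i j.
rewrite /first_form grad_axis// !mxE big_ord1 mxE !axis_coord.
have [->|ij] := eqVneq i j.
  by case: eqP; rewrite ?mulr1n ?mulr0n ?mulr0 ?expr2.
have [ii0|ii0] := eqVneq i i0; last by rewrite mulr0n mul0r addr0.
have [ji0|ji0] := eqVneq j i0; last by rewrite mulr0n mulr0 addr0.
by rewrite ii0 ji0 eqxx in ij.
Qed.

(** The first form is diagonal on the axis, so the shape operator keeps the zero pattern of the
    Hessian and its eigenvalues are its diagonal entries. *)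
Lemma principal_curvatures_axis (r : R) : 0 < r ->
  principal_curvatures u (r *: e0)
    (\row_i ((1 + p r ^+ 2 *+ (i == i0))^-1 * ((area_factor u (r *: e0))^-1 *
       (if i == i0 then q r else p r / r)))).
Proof.
move=> r0; rewrite /principal_curvatures char_poly_trig.
  apply: eq_bigr => i _; congr (_ - _%:P).
  rewrite /shape_operator first_form_axis// invmx_diag => [|j].
    rewrite mul_diag_mx !mxE; congr (_ * (_ * _)).
    by case: eqVneq => [->//|ii0]; rewrite (hessian_diag u_C2 u_rot).
  by rewrite mxE gt_eqF// ltr_wpDr// mulrn_wge0// sqr_ge0.
(* Triangularity is enough, which spares the entries below the diagonal. *)
apply/is_trig_mxP => i j ij.
rewrite /shape_operator first_form_axis// invmx_diag => [|k].
  rewrite mul_diag_mx !mxE (hessian_offdiag u_C2 u_rot) ?mulr0//.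
    by apply: contraTneq ij => ->; rewrite i00 ltn0.
  by rewrite neq_ltn ij.
by rewrite mxE gt_eqF// ltr_wpDr// mulrn_wge0// sqr_ge0.
Qed.

(* 1-homogeneity strips the factor p / (r sqrt (1 + p ^ 2)) off the curvatures. *)
Lemma translator_ode (r : R) : 0 < r ->
  f (r * q r / (p r * (1 + p r ^+ 2)) *: e0 + zero_e R n) = r / p r.
Proof.
move=> r0; have p0 := slope_gt0 r0; have q0 := slope_derive_ge0 r.
have [_] := bowl_translator hu (principal_curvatures_axis r0).
have W0 : 0 < area_factor u (r *: e0).
  by rewrite area_factor_axis// sqrtr_gt0 ltr_wpDr// sqr_ge0.
have D0 : 0 < 1 + p r ^+ 2 by rewrite ltr_wpDr// sqr_ge0.
set W := area_factor _ _ in W0 *; set lam := \row_i _.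
set tau := r * q r / _.
have tau0 : 0 <= tau by rewrite divr_ge0 ?mulr_ge0// ltW// mulr_gt0.
have c0 : 0 < p r / (r * W) by rewrite divr_gt0// mulr_gt0.
have -> : lam = (p r / (r * W)) *: (tau *: e0 + zero_e R n).
  apply/rowP => i; rewrite !mxE eqxx/=.
  have [->|ii0] := eqVneq i i0.
    by rewrite i00 /tau !mulr1n /=; field; rewrite !gt_eqF.
  have -> : (0 < i)%N.
    rewrite lt0n; apply: contra_neq ii0 => i_0.
    by apply: val_inj; rewrite /= i_0 i00.
  by rewrite /= !mulr0n; field; rewrite !gt_eqF.
rewrite (speed_homo hf)//; last exact: (speed_ray i00 hf hnd).
move=> h; rewrite -[LHS](mulKf (lt0r_neq0 c0)) h.
by field; rewrite !gt_eqF.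
Qed.

(** The derivative of [r / p] is [1 / p - r q / p^2], and the last term is
    [t (1 + p^2) / p = t (y / r + r / y)]. *)
Lemma bowl_slope_ode :
  slope_ode (fun s => f (s *: e0 + zero_e R n)) (fun r => r / p r)
    (fun r => r * q r / (p r * (1 + p r ^+ 2))).
Proof.
split=> r r0; have p0 := slope_gt0 r0; have q0 := slope_derive_ge0 r.
- by rewrite divr_gt0.
- by rewrite divr_ge0 ?mulr_ge0 ?addr_ge0 ?sqr_ge0// ltW.
- exact: translator_ode.
have pN0 : p r != 0 by rewrite gt_eqF.
have D0 : 0 < 1 + p r ^+ 2 by rewrite ltr_wpDr// sqr_ge0.
apply: (is_derive_eq (is_deriveM (is_derive_id r 1)
  (is_deriveV pN0 (is_derive_slope i0 u_C2 r)))).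
by rewrite /GRing.scale/=; field; rewrite !gt_eqF.
Qed.

End bowl.

Theorem theorem1p1 (R : realType) (n : nat) (hn : (2 <= n)%N)
    (Gam : set 'rV[R]_n) (f : 'rV[R]_n -> R) (u : 'rV[R]_n -> R)
    (hf : speed_function Gam f) (hnd : nondegenerate_speed Gam f)
    (hu : entire_bowl Gam f u) :
  exists c C r0 : R, 0 < r0 /\
    forall x : 'rV[R]_n, r0 <= enorm x ->
      `| (u x + c) -
         (enorm x ^+ 2 / (2 * f (zero_e R n))
          - partial (Ordinal (ltnW hn)) f (zero_e R n) * ln (enorm x)) |
      <= C * (enorm x)^-1.
Proof.
set i0 := Ordinal _.
have i00 : i0 = 0%N :> nat by [].
have hg := speed_profile_ray i00 hf hnd.
have hy := bowl_slope_ode i00 hf hnd hu.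
pose e0 : 'rV[R]_n := delta_mx 0 i0.
have dphi (r : R) : 0 < r -> is_derive r 1 (fun s => u (s *: e0))
    (r / (r / partial i0 u (r *: e0))).
  move=> r0; have p0 := slope_gt0 i0 hu r0.
  apply: (is_derive_eq (is_derive_profile i0 (bowl_C2 hu) r)).
  by rewrite invf_div mulrC divfK// gt_eqF.
have [c [C [M [_ hM]]]] := profile_asymptotics hg hy dphi.
(* The eventual bound holds strictly beyond [M], hence the [M + 1]; the 1 makes the threshold
   positive. *)
exists c, C, (Num.max 1 (M + 1)); split; first by rewrite lt_max ltr01.
move=> x; rewrite ge_max => /andP[_ Mx].
rewrite (radial_profile i0 (bowl_rotationally_symmetric hu)).
by apply: hM; apply: lt_le_trans Mx; rewrite ltrDl.
Qed.
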